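(* Let $p_1,p_2\ge1$ be integers and let $0\le\alpha_1<p_1$, $0\le\alpha_2<p_2$. Then for every $k\in\mathbb R$, $$\int_{\mathbb R} D^{\alpha_1}_{-\infty,x}\phi_{p_1}(x)\,D^{\alpha_2}_{x,+\infty}\phi_{p_2}(x+k)\,dx = D^{\alpha_1+\alpha_2}_{-\infty,x}\phi_{p_1+p_2+1}(p_2+1-k),$$ $$\int_{\mathbb R} D^{\alpha_1}_{x,+\infty}\phi_{p_1}(x)\,D^{\alpha_2}_{-\infty,x}\phi_{p_2}(x+k)\,dx = D^{\alpha_1+\alpha_2}_{x,+\infty}\phi_{p_1+p_2+1}(p_2+1-k),$$ where $D^{\beta}_{\cdot}\phi_q(y)$ denotes the fractional derivative (as a function of $x$) evaluated at $x=y$.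
   Context: The cardinal B-spline $\phi_p:\mathbb R\to\mathbb R$ is defined by $\phi_0(t)=1$ for $t\in[0,1)$, $\phi_0(t)=0$ otherwise, and $\phi_p(t)=\frac{t}{p}\phi_{p-1}(t)+\frac{p+1-t}{p}\phi_{p-1}(t-1)$ for $p\ge1$; it belongs to $C^{p-1}(\mathbb R)$ and is supported on $[0,p+1]$. For a compactly supported function $u$ with absolutely continuous $(m-1)$-th derivative on $\mathbb R$, where $m$ is the integer with $m-1\le\alpha<m$, the half-axis Riemann–Liouville fractional derivatives are $D^{\alpha}_{-\infty,x}u(x)=\frac{1}{\Gamma(m-\alpha)}\frac{d^m}{dx^m}\int_{-\infty}^x (x-y)^{m-\alpha-1}u(y)\,dy$ and $D^{\alpha}_{x,+\infty}u(x)=\frac{(-1)^m}{\Gamma(m-\alpha)}\frac{d^m}{dx^m}\int_x^{+\infty}(y-x)^{m-\alpha-1}u(y)\,dy$. *)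

(* Defs.v *)
From HB Require Import structures.
From mathcomp Require Import all_boot all_order all_algebra.
From mathcomp Require Import all_classical all_reals all_analysis.
Set Implicit Arguments. Unset Strict Implicit. Unset Printing Implicit Defensive.
Import Order.TTheory GRing.Theory Num.Theory.
Import numFieldNormedType.Exports.
Local Open Scope classical_set_scope.
Local Open Scope ring_scope.

Section FracDefs.
Variable R : realType.

Fixpoint bspline (p : nat) (t : R) : R :=
  match p with
  | 0%N => if (0 <= t) && (t < 1) then 1 else 0
  | p'.+1 => t / p'.+1%:R * bspline p' t
             + (p'.+1%:R + 1 - t) / p'.+1%:R * bspline p' (t - 1)
  end.

Definition Gamma (s : R) : R :=
  Rintegral (@lebesgue_measure R) `]0, +oo[
    (fun t => powR t (s - 1) * expR (- t)).

Definition fracm (a : R) : nat := (Num.truncn a).+1.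

Definition RL_left (a : R) (u : R -> R) (x : R) : R :=
  (Gamma ((fracm a)%:R - a))^-1 *
  derive1n (fracm a)
    (fun z => Rintegral (@lebesgue_measure R) `]-oo, z[
        (fun y => powR (z - y) ((fracm a)%:R - a - 1) * u y)) x.

Definition RL_right (a : R) (u : R -> R) (x : R) : R :=
  (-1) ^+ (fracm a) / Gamma ((fracm a)%:R - a) *
  derive1n (fracm a)
    (fun z => Rintegral (@lebesgue_measure R) `]z, +oo[
        (fun y => powR (y - z) ((fracm a)%:R - a - 1) * u y)) x.

End FracDefs.

(* Main.v *)
(* Let K_s(x) = x_+^(s-1) / Gamma(s) and let nabla f(x) = f(x) - f(x-1). For
   p >= 1 the B-spline phi_p is nabla^(p+1) K_(p+1). Euler's Beta integral says
   K_s * K_t = K_(s+t), and K_(s+1)' = K_s everywhere when s > 1; as nabla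
   commutes with convolution and differentiation, D^a_left phi_p is
   nabla^(p+1) K_(p+1-a) for a < p. The symmetry phi_p(p+1-x) = phi_p(x) turns
   D^a_right phi_p into the reflection x |-> p+1-x of the same function. Both
   identities then reduce to
   nabla^m K_s * nabla^n K_t = nabla^(m+n) K_(s+t). *)
Require Import Defs.
From HB Require Import structures.
From mathcomp Require Import all_boot all_order all_algebra.
From mathcomp Require Import all_classical all_reals all_analysis.
From mathcomp Require Import measurable_realfun ring lra.
Import Order.TTheory GRing.Theory Num.Theory.
Import numFieldNormedType.Exports.
Local Open Scope classical_set_scope.
Local Open Scope ring_scope.

(** * Affine substitutions in Lebesgue integrals over the line *)

Section AffineChangeOfVariables.
Context {R : realType}.
Notation mu := (@lebesgue_measure R).

Lemma measurable_affine (c b : R) : measurable_fun setT (fun x : R => c + b * x).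
Proof. by apply: measurable_funD => //; apply: measurable_funM. Qed.

Lemma preimage_affine_itvoc (c b l r : R) : b != 0 ->
  (fun x => c + b * x) @^-1` `]l, r] =
  if 0 < b then `](l - c) / b, (r - c) / b]%classic
  else `[(r - c) / b, (l - c) / b[%classic.
Proof.
move=> b0; case: ifPn => [bp|bn]; apply/seteqP; split => x /=; rewrite !in_itv/=.
- by rewrite ltr_pdivrMr// ler_pdivlMr// ltrBlDl lerBrDl [x * b]mulrC.
- by rewrite ltr_pdivrMr// ler_pdivlMr// ltrBlDl lerBrDl [x * b]mulrC.
- have bn' : b < 0 by rewrite lt_neqAle b0 /= leNgt.
  by rewrite ler_ndivrMr// ltr_ndivlMr// ltrBlDl lerBrDl [x * b]mulrC andbC.
- have bn' : b < 0 by rewrite lt_neqAle b0 /= leNgt.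
  by rewrite ler_ndivrMr// ltr_ndivlMr// ltrBlDl lerBrDl [x * b]mulrC andbC.
Qed.

(** The right-hand side is a measure in [A], so by uniqueness of Lebesgue measure it is enough to
    compare lengths on half-open intervals. For [b < 0] the preimage is half-open on the other side,
    which does not change its length. *)
Lemma lebesgue_measure_affine (c b : R) (A : set R) : b != 0 -> measurable A ->
  mu A = (`|b|%:E * mu ((fun x : R => (c + b * x)%R) @^-1` A))%E.
Proof.
move=> b0 mA.
pose f : measurableTypeR R -> measurableTypeR R := fun x => c + b * x.
have mf : measurable_fun setT f := measurable_affine c b.
pose nu := mscale (NngNum (normr_ge0 b)) (pushforward mu f).
have nuE X : ocitv X -> mu X = nu mf X.
  move=> /ocitvP[->|[[l r]/= lr ->]]; first by rewrite !measure0.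
  pose J := if 0 < b then `](l - c) / b, (r - c) / b]%classic
    else `[(r - c) / b, (l - c) / b[%classic.
  have -> : nu mf `]l, r]%classic = (`|b|%:E * mu J)%E.
    rewrite /nu /mscale /pushforward /=; congr (_ * mu _)%E.
    exact: preimage_affine_itvoc.
  rewrite /J lebesgue_measure_itv/= lte_fin lr.
  case: ifPn => b1; rewrite lebesgue_measure_itv/= lte_fin.
    rewrite ltr_pM2r ?invr_gt0// ltrD2r lr -EFinB -EFinM gtr0_norm//.
    by congr EFin; field.
  have bn' : b < 0 by rewrite lt_neqAle b0 /= leNgt.
  rewrite ltr_nM2r ?invr_lt0// ltrD2r lr -EFinB -EFinM ltr0_norm//.
  by congr EFin; field.
exact: (lebesgue_measure_unique nuE).
Qed.

Lemma ge0_integral_affine (c b : R) (f : R -> \bar R) : b != 0 ->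
  measurable_fun [set: R] f -> (forall x, 0 <= f x)%E ->
  (\int[mu]_x f x = `|b|%:E * \int[mu]_x f (c + b * x)%R)%E.
Proof.
move=> b0 mf f0.
pose phi : measurableTypeR R -> measurableTypeR R := fun x => c + b * x.
have mphi : measurable_fun setT phi := measurable_affine c b.
pose nu := mscale (NngNum (normr_ge0 b)) (pushforward mu phi).
have -> : (\int[mu]_x f x = \int[nu mphi]_x f x)%E.
  apply: (eq_measure_integral (nu mphi)) => A mA _.
  exact: lebesgue_measure_affine.
rewrite ge0_integral_mscale//; congr (_ * _)%E.
by rewrite (ge0_integral_pushforward mphi)// preimage_setT.
Qed.

(** The affine rule with slope -1 is applied to the positive and negative parts separately, so only
    measurability of [f] is asked for. *)
Lemma integral_reflect (c : R) (f : R -> \bar R) : measurable_fun [set: R] f ->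
  (\int[mu]_x f x = \int[mu]_x f (c - x)%R)%E.
Proof.
move=> mf.
have H (g : R -> \bar R) : measurable_fun [set: R] g -> (forall x, 0 <= g x)%E ->
    (\int[mu]_x g x = \int[mu]_x g (c - x)%R)%E.
  move=> mg g0; rewrite (ge0_integral_affine c (-1))// ?oppr_eq0 ?oner_eq0//.
  by rewrite normrN1 mul1e; apply: eq_integral => x _; rewrite mulN1r.
rewrite integralE [RHS]integralE; congr (_ - _)%E.
- rewrite (H (f^\+)%E)//; last exact: measurable_funepos.
  by apply: eq_integral => x _; rewrite !funeposE.
- rewrite (H (f^\-)%E)//; last exact: measurable_funeneg.
  by apply: eq_integral => x _; rewrite !funenegE.
Qed.

Lemma integrable_reflect (c : R) (f : R -> \bar R) :
  mu.-integrable setT f -> mu.-integrable setT (fun x => f (c - x)).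
Proof.
move=> /integrableP[mf fi].
have mg : measurable_fun [set: R] (fun x : R => f (c - x)).
  by apply: measurableT_comp => //; apply: measurable_funB.
apply/integrableP; split => //.
by rewrite -(@integral_reflect c (fun x => `|f x|)%E)//; exact: measurableT_comp.
Qed.

End AffineChangeOfVariables.

(** * Euler's Gamma and Beta integrals *)

Section GammaBeta.
Context {R : realType}.
Notation mu := (@lebesgue_measure R).
Implicit Types s t x : R.

(** For [s < 1] the integrand blows up at 0, so the fundamental theorem is used on [[a, 1]] only;
    monotone convergence along [a = 1/(n+1)] then reaches the whole interval. *)
Lemma integral01_powR s : 0 < s ->
  (\int[mu]_(x in `]0%R, 1%R]) (x `^ (s - 1))%:E = (s^-1)%:E)%E.
Proof.
move=> s0.
have ftc (a : R) : 0 < a -> a <= 1 ->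
    (\int[mu]_(x in `[a, 1%R]) (x `^ (s - 1))%:E = (s^-1 - s^-1 * a `^ s)%:E)%E.
  move=> a0; rewrite le_eqVlt => /predU1P[->|a1].
    by rewrite set_itv1 integral_set1 powR1 mulr1 subrr.
  have dF x : 0 < x -> is_derive x 1 (fun y => s^-1 * y `^ s) (x `^ (s - 1)).
    move=> x0; have := is_derive1_powR s x0 => h.
    by apply: is_derive_eq; rewrite /GRing.scale/= mulrA mulVf ?gt_eqF// mul1r.
  have cp (r x : R) : 0 < x -> {for x, continuous (fun y : R => y `^ r)}.
    move=> x0; apply/differentiable_continuous/derivable1_diffP.
    by have [] := is_derive1_powR r x0.
  rewrite (@continuous_FTC2 _ _ (fun y => s^-1 * y `^ s))//.
  - by rewrite powR1 mulr1 -EFinB.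
  - apply: continuous_in_subspaceT => x /[!inE]/= /[!in_itv]/= /andP[ax _].
    exact/cp/(lt_le_trans a0).
  - split.
    + move=> x; rewrite in_itv/= => /andP[ax _].
      by have [] := dF x (lt_trans a0 ax).
    + apply: cvgMr; apply: cvg_at_right_filter; exact: cp.
    + apply: cvgMr; apply: cvg_at_left_filter; exact: cp.
  - move=> x; rewrite in_itv/= => /andP[ax _].
    by rewrite derive1E; have [_ ->] := dF x (lt_trans a0 ax).
have := @itv_open_bnd_bigcup R false 1 0 => ->.
have step := @ge0_nondecreasing_set_cvg_integral _ (measurableTypeR R) R (fun n => `[0 + n.+1%:R^-1, 1 : R]%classic) (fun x => (x `^ (s - 1))%:E) mu.
apply/esym; apply: cvg_unique (step _ _ _ _) => //.
- rewrite (_ : (fun n => _) = (fun n : nat => (s^-1 - s^-1 * (n.+1%:R^-1) `^ s)%:E)); last first.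
    apply/funext => n; rewrite add0r ftc ?invr_gt0//.
    by rewrite invf_le1// ler1n.
  apply: cvg_EFin; first exact: nearW.
  rewrite -[X in _ --> X]subr0; apply: cvgB; first exact: cvg_cst.
  rewrite -[X in _ --> X](mulr0 s^-1); apply: cvgMr.
  have /cvg_at_rightP := @powR_cvg0 R s s0; apply; split => [n|].
    by rewrite invr_gt0.
  exact: cvg_harmonic.
- move=> m n mn; rewrite subsetEset => x /=; rewrite !in_itv/= !add0r => /andP[mx ->].
  by rewrite andbT (le_trans _ mx)// lef_pV2 ?posrE// ler_nat.
- by move=> n; apply/measurable_EFinP; apply: measurable_funTS; exact: measurable_powR.
- by move=> n x _; rewrite lee_fin powR_ge0.
Qed.

(** The truncated power is total on the line, so Euler's integrals become integrals over all of [R].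
    The test is strict, so [tpow 1] is the Heaviside step with value 0 at 0. *)
Definition tpow s x : R := if 0 < x then x `^ (s - 1) else 0.

Lemma tpow_ge0 s x : 0 <= tpow s x.
Proof. by rewrite /tpow; case: ifP => // _; exact: powR_ge0. Qed.

Lemma measurable_tpow s : measurable_fun [set: R] (tpow s).
Proof. by apply: measurable_fun_ifT => //; apply: measurable_fun_ltr. Qed.

Lemma measurable_tpow_conv s t x :
  measurable_fun [set: R] (fun y => tpow s y * tpow t (x - y)).
Proof.
apply: measurable_funM; first exact: measurable_tpow.
by apply: (measurableT_comp (measurable_tpow t)); apply: measurable_funB.
Qed.

Lemma tpowM s x y : 0 < x -> tpow s (x * y) = x `^ (s - 1) * tpow s y.
Proof.
move=> x0; rewrite /tpow pmulr_rgt0//; case: ifPn => [y0|]; last by rewrite mulr0.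
by rewrite powRM// ltW.
Qed.

Lemma tpowS s x : tpow (s + 1) x = x * tpow s x.
Proof.
rewrite /tpow; case: ifPn => [x0|]; last by rewrite mulr0.
rewrite addrK -{2}(powRr1 (ltW x0)) -powRD; last by rewrite (gt_eqF x0) implybT.
by rewrite addrC subrK.
Qed.

(** Extended-real values allow comparison and Tonelli arguments before finiteness is known. *)
Definition Gammae s : \bar R := \int[mu]_x (tpow s x * expR (- x))%:E.

Lemma integral_tpow (f : R -> R) s :
  (\int[mu]_x (tpow s x * f x)%:E = \int[mu]_(x in `]0%R, +oo[) (x `^ (s - 1) * f x)%:E)%E.
Proof.
rewrite [RHS]integral_mkcond; apply: eq_integral => x _.
rewrite /tpow patchE mem_setE in_itv/= andbT.
by case: ifP => _; rewrite ?mul0r.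
Qed.

Lemma GammaE s : Gamma s = fine (Gammae s).
Proof. by rewrite /Gammae (integral_tpow (fun x => expR (- x))). Qed.

(* Otherwise unification unfolds [Gamma] down to the integral. *)
Opaque Gamma.

Lemma measurable_tpow_expR s : measurable_fun [set: R] (fun x => tpow s x * expR (- x)).
Proof.
apply: measurable_funM; first exact: measurable_tpow.
by apply: measurableT_comp => //; apply: measurable_funN.
Qed.

(** This is the Beta value B(s,1): the factor [tpow 1 (1 - x)] cuts the integral off at 1. *)
Lemma integral01_tpow s : 0 < s ->
  (\int[mu]_x (tpow s x * tpow 1 (1 - x))%:E = (s^-1)%:E)%E.
Proof.
move=> s0; rewrite -(integral01_powR s s0) -integral_itv_bndo_bndc; last first.
  by apply/measurable_EFinP; apply: measurable_funTS; exact: measurable_powR.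
rewrite [RHS]integral_mkcond; apply: eq_integral => x _.
rewrite /tpow patchE mem_setE in_itv/= subr_gt0 subrr powRr0.
by case: ifP => _; case: ifP => _; rewrite ?mul0r ?mulr0 ?mulr1.
Qed.

(** Below 1 one has [exp (-x) >= exp (-1)], so the integral is at least [exp (-1)] times B(s,1). *)
Lemma Gammae_gt0 s : 0 < s -> (0 < Gammae s)%E.
Proof.
move=> s0.
have : (0 < (expR (-1))%:E * \int[mu]_x (tpow s x * tpow 1 (1 - x))%:E)%E.
  by rewrite integral01_tpow// -EFinM lte_fin mulr_gt0 ?expR_gt0 ?invr_gt0.
have m1 := measurable_tpow_conv s 1 1.
have p1 x : 0 <= tpow s x * tpow 1 (1 - x) by rewrite mulr_ge0 ?tpow_ge0.
move/lt_le_trans; apply; rewrite -ge0_integralZl//; last 2 first.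
- exact/measurable_EFinP.
- by move=> x _; rewrite lee_fin.
apply: ge0_le_integral => //.
- by move=> x _; rewrite -EFinM lee_fin mulr_ge0 ?expR_ge0.
- by apply/measurable_EFinP; apply: measurable_funM.
- by apply/measurable_EFinP; exact: measurable_tpow_expR.
- move=> x _; rewrite -EFinM lee_fin mulrCA ler_wpM2l ?tpow_ge0//.
  rewrite /tpow subrr powRr0; case: ifPn => [|_]; last by rewrite mulr0 expR_ge0.
  by rewrite subr_gt0 mulr1 ler_expR lerN2 => /ltW.
Qed.

Lemma Gammae_lty s : 0 < s -> (Gammae s < +oo)%E.
Proof.
(* Beyond [1], [x^(s-1) exp (-x) <= (2s)^s exp (-x/2)] because
   [x/(2s) <= exp (x/(2s))]. *)
move=> s0.
(* The exponential density of rate 1/2 is [exp (-x/2) / 2]; the last factor 2 undoes its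
   normalisation. *)
pose C := (2 * s) `^ s * 2.
have C0 : 0 <= C by rewrite mulr_ge0 ?powR_ge0.
have m1 := measurable_tpow_conv s 1 1.
have p1 x : 0 <= tpow s x * tpow 1 (1 - x) by rewrite mulr_ge0 ?tpow_ge0.
have mE := @measurable_exponential_pdf R 2^-1.
have pE x : 0 <= exponential_pdf (2^-1 : R) x by apply: exponential_pdf_ge0.
apply: (@le_lt_trans _ _ (\int[mu]_x (tpow s x * tpow 1 (1 - x)
    + C * exponential_pdf 2^-1 x)%:E)%E); last first.
  under eq_integral do rewrite EFinD.
  rewrite ge0_integralD//; first last.
  - by apply/measurable_EFinP; apply: measurable_funM.
  - by move=> x _; rewrite lee_fin mulr_ge0.
  - exact/measurable_EFinP.
  - by move=> x _; rewrite lee_fin.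
  rewrite integral01_tpow//; under eq_integral do rewrite EFinM.
  rewrite ge0_integralZl//; last 2 first.
  - exact/measurable_EFinP.
  - by move=> x _; rewrite lee_fin.
  by rewrite integral_exponential_pdf ?invr_gt0// mule1 -EFinD ltry.
apply: ge0_le_integral => //.
- by move=> x _; rewrite lee_fin mulr_ge0 ?expR_ge0 ?tpow_ge0.
- by apply/measurable_EFinP; exact: measurable_tpow_expR.
- by apply/measurable_EFinP; apply: measurable_funD => //; apply: measurable_funM.
- move=> x _; rewrite lee_fin {1 2}/tpow.
  case: ifPn => [x0|_]; last by rewrite mul0r mul0r add0r mulr_ge0.
  rewrite /tpow subrr powRr0 subr_gt0; case: ifPn => [x1|].
    rewrite mulr1; apply: ler_wpDr; first by rewrite mulr_ge0.
    rewrite ler_piMr ?powR_ge0//.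
    by rewrite -expR0 ler_expR oppr_le0 ltW.
  rewrite -leNgt mulr0 add0r => x1.
  have -> : C * exponential_pdf 2^-1 x = (2 * s) `^ s * expR (- 2^-1 * x).
    by rewrite exponential_pdfE ?ltW// /C mulrA -(mulrA _ 2) mulfV ?pnatr_eq0// mulr1.
  have -> : expR (- x) = expR (- 2^-1 * x) * expR (- 2^-1 * x).
    by rewrite -expRD; congr expR; field.
  rewrite mulrA ler_wpM2r ?expR_ge0//.
  rewrite mulNr expRN ler_pdivrMr ?expR_gt0//.
  apply: (@le_trans _ _ (x `^ s)); first by rewrite ler_powR// lerBlDr lerDl.
  have -> : x = (2 * s) * (x / (2 * s)) by field; rewrite gt_eqF.
  rewrite powRM ?mulr_ge0 ?ler0n ?invr_ge0 ?mulr_ge0 ?ler0n ?(ltW x0) ?(ltW s0)//.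
  rewrite ler_wpM2l ?powR_ge0//.
  have -> : 2^-1 * (2 * s * (x / (2 * s))) = x / (2 * s) * s by field; rewrite gt_eqF.
  rewrite expRM ge0_ler_powR ?nnegrE ?(ltW s0) ?expR_ge0//.
    by rewrite divr_ge0 ?mulr_ge0 ?ler0n ?(ltW x0) ?(ltW s0).
  by rewrite (le_trans _ (expR_ge1Dx _))// lerDr.
Qed.

Lemma Gammae_fin s : 0 < s -> Gammae s \is a fin_num.
Proof. by move=> s0; rewrite ge0_fin_numE ?Gammae_lty// ltW// Gammae_gt0. Qed.

Lemma EFin_Gamma s : 0 < s -> (Gamma s)%:E = Gammae s.
Proof. by move=> s0; rewrite GammaE fineK// Gammae_fin. Qed.

Lemma Gamma_gt0 s : 0 < s -> 0 < Gamma s.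
Proof. by move=> s0; rewrite -lte_fin EFin_Gamma// Gammae_gt0. Qed.

Lemma Gamma1 : Gamma (1 : R) = 1.
Proof.
apply: (@EFin_inj R); rewrite EFin_Gamma// -(integral_exponential_pdf (ltr01 : 0 < 1 :> R)).
rewrite /Gammae (integral_tpow (fun x => expR (- x))) integral_itv_obnd_cbnd.
  rewrite integral_mkcond; apply: eq_integral => x _.
  rewrite /exponential_pdf !patchE; case: ifP => // _.
  by rewrite subrr powRr0 !mul1r mulNr mul1r.
apply/measurable_EFinP; apply: measurable_funTS; apply: measurable_funM => //.
by apply: measurableT_comp => //; apply: measurable_funN.
Qed.

(** Substituting [x * y] for [y] pulls out the powers of [x] by homogeneity; for [x <= 0] the
    supports of the two factors are disjoint. *)
Lemma tpow_convE s t x :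
  (\int[mu]_y (tpow s y * tpow t (x - y))%:E =
   (tpow (s + t) x)%:E * \int[mu]_y (tpow s y * tpow t (1 - y))%:E)%E.
Proof.
case: (ltP 0 x) => x0; last first.
  rewrite {3}/tpow ltNge x0 mul0e integral0_eq// => y _.
  rewrite /tpow; case: ifPn => y0; last by rewrite mul0r.
  by rewrite subr_gt0 ltNge (le_trans x0 (ltW y0)) mulr0.
have m0 := measurable_tpow_conv s t.
have p0 z y : (0 <= (tpow s y * tpow t (z - y))%:E)%E.
  by rewrite lee_fin mulr_ge0 ?tpow_ge0.
rewrite (ge0_integral_affine 0 x); [|by rewrite gt_eqF|by apply/measurable_EFinP; exact: m0|by []].
have -> : tpow (s + t) x = x * (x `^ (s - 1) * x `^ (t - 1)).
  rewrite /tpow x0 -powRD; last by rewrite (gt_eqF x0) implybT.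
  rewrite -{2}(powRr1 (ltW x0)) -powRD; last by rewrite (gt_eqF x0) implybT.
  by congr (_ `^ _); ring.
rewrite (gtr0_norm x0) EFinM -muleA; congr (_ * _)%E.
rewrite -ge0_integralZl//; last 2 first.
- by apply/measurable_EFinP; exact: m0.
- by rewrite lee_fin mulr_ge0 ?powR_ge0.
apply: eq_integral => y _; rewrite add0r -EFinM; congr EFin.
have -> : x - x * y = x * (1 - y) by ring.
by rewrite !tpowM// mulrACA.
Qed.

(* The integrand [tpow s y * tpow t u * exp (- y - u)] over the plane is summed
   along the lines [y + u = x]. *)
Lemma Gammae_mul s t : 0 < s -> 0 < t ->
  (Gammae s * Gammae t =
   Gammae (s + t) * \int[mu]_y (tpow s y * tpow t (1 - y))%:E)%E.
Proof.
move=> s0 t0; set B := (\int[mu]_y _)%E.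
pose f (z : R * R) := (tpow s z.1 * tpow t (z.2 - z.1) * expR (- z.2))%:E.
have f0 z : (0 <= f z)%E by rewrite lee_fin !mulr_ge0 ?tpow_ge0 ?expR_ge0.
have mf : measurable_fun [set: R * R] f.
  apply/measurable_EFinP; apply: measurable_funM; [apply: measurable_funM|].
  - exact: measurableT_comp (measurable_tpow s) measurable_fst.
  - apply: (measurableT_comp (measurable_tpow t)); apply: measurable_funB.
      exact: measurable_snd.
    exact: measurable_fst.
  - apply: (measurableT_comp (@measurable_expR R)); apply: measurableT_comp => //.
have B0 : (0 <= B)%E.
  by apply: integral_ge0 => y _; rewrite lee_fin mulr_ge0 ?tpow_ge0.
transitivity (\int[mu]_y \int[mu]_x f (y, x))%E; last first.
  etransitivity; first exact: (@fubini_tonelli _ _ _ _ R mu mu f mf f0).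
  rewrite /Gammae /=.
  rewrite -ge0_integralZr//; last 2 first.
  - by apply/measurable_EFinP; exact: measurable_tpow_expR.
  - by move=> x _; rewrite lee_fin mulr_ge0 ?tpow_ge0 ?expR_ge0.
  apply: eq_integral => x _; rewrite /f /=.
  under eq_integral do rewrite EFinM.
  rewrite ge0_integralZr//; last 2 first.
  - by apply/measurable_EFinP; exact: measurable_tpow_conv.
  - by move=> y _; rewrite lee_fin mulr_ge0 ?tpow_ge0.
  by rewrite tpow_convE EFinM muleAC.
rewrite -ge0_integralZr//; last 3 first.
- by apply/measurable_EFinP; exact: measurable_tpow_expR.
- by move=> x _; rewrite lee_fin mulr_ge0 ?tpow_ge0 ?expR_ge0.
- exact/ltW/Gammae_gt0.
apply: eq_integral => y _.
rewrite [RHS](ge0_integral_affine y 1); [|exact: oner_neq0| |by []]; last first.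
  exact: measurableT_comp mf (measurable_pair1 _).
rewrite normr1 mul1e -ge0_integralZl//; last 3 first.
- by apply/measurable_EFinP; exact: measurable_tpow_expR.
- by move=> x _; rewrite lee_fin mulr_ge0 ?tpow_ge0 ?expR_ge0.
- by rewrite lee_fin mulr_ge0 ?tpow_ge0 ?expR_ge0.
apply: eq_integral => u _; rewrite /f -EFinM; congr EFin => /=.
rewrite mul1r addrAC subrr add0r opprD expRD; ring.
Qed.

Lemma tpow_conv s t x : 0 < s -> 0 < t ->
  (\int[mu]_y (tpow s y * tpow t (x - y))%:E =
   (tpow (s + t) x * (Gamma s * Gamma t / Gamma (s + t)))%:E)%E.
Proof.
move=> s0 t0; have G0 := Gamma_gt0 _ (addr_gt0 s0 t0).
(* The Beta integral is not yet known to be finite; the product formula forces it, since all three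
   Gamma values are finite and [Gamma (s + t)] is positive. *)
have divG (B : \bar R) : ((Gamma s)%:E * (Gamma t)%:E = (Gamma (s + t))%:E * B)%E ->
    B = (Gamma s * Gamma t / Gamma (s + t))%:E.
  case: B => [r [->]| |].
  - by congr EFin; field; rewrite gt_eqF.
  - by rewrite mulry (gtr0_sg G0) mul1e.
  - by rewrite mulrNy (gtr0_sg G0) mul1e.
rewrite tpow_convE EFinM; congr (_ * _)%E; apply: divG.
have := Gammae_mul s t s0 t0.
by rewrite -(EFin_Gamma s s0) -(EFin_Gamma t t0) -(EFin_Gamma _ (addr_gt0 s0 t0)).
Qed.

(** B(s,1) equals 1/s by direct integration and [Gamma s / Gamma (s + 1)] by Euler's formula. *)
Lemma GammaS s : 0 < s -> Gamma (s + 1) = s * Gamma s.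
Proof.
move=> s0; have := tpow_conv s 1 1 s0 ltr01; rewrite integral01_tpow// => -[].
have G0 := Gamma_gt0 _ (addr_gt0 s0 ltr01).
rewrite Gamma1 /tpow ltr01 powR1 mul1r mulr1 => E.
have sn : s != 0 by rewrite gt_eqF.
have Gn : Gamma (s + 1) != 0 by rewrite gt_eqF.
have -> : Gamma (s + 1) = s * (s^-1 * Gamma (s + 1)) by field.
by rewrite E divfK.
Qed.

Lemma Gamma_fact n : Gamma (n.+1%:R : R) = n`!%:R.
Proof.
elim: n => [|n IH]; first exact: Gamma1.
by rewrite -(natr1 n.+1) GammaS// IH factS natrM.
Qed.

End GammaBeta.

(** * Backward differences and B-splines as differences of truncated powers *)

Section Nabla.
Context {R : realType}.
Implicit Types (f g : R -> R) (n : nat) (x c : R).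

Definition nabla f : R -> R := fun x => f x - f (x - 1).

Lemma iter_nablaZ n c f x : iter n nabla (fun y => c * f y) x = c * iter n nabla f x.
Proof. by elim: n x => //= n IH x; rewrite /nabla !IH mulrBr. Qed.

(** A discrete Leibniz rule: the identity function has [nabla] equal to 1, so only two terms
    survive. It is what matches the B-spline recursion. *)
Lemma iter_nablaM_id n f x : iter n.+1 nabla (fun y => y * f y) x =
  x * iter n.+1 nabla f x + n.+1%:R * iter n nabla f (x - 1).
Proof.
elim: n x => [|n IH] x; first by rewrite /= /nabla; ring.
rewrite -[LHS]/(nabla (iter n.+1 nabla (fun y => y * f y)) x) /nabla !IH.
rewrite -[iter n.+2 nabla f x]/(iter n.+1 nabla f x - iter n.+1 nabla f (x - 1)).
rewrite -[iter n.+1 nabla f (x - 1)]/(iter n nabla f (x - 1) - iter n nabla f (x - 1 - 1)).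
rewrite -(natr1 n.+1); ring.
Qed.

Lemma eq_iter_nabla n f g : f =1 g -> iter n nabla f =1 iter n nabla g.
Proof. by move=> fg; elim: n => //= n IH x; rewrite /nabla !IH. Qed.

(** Writing [y ^+ p.+1] as [y * y ^+ p] and applying the Leibniz rule reproduces the recursion. The
    non-strict test [0 <= y] makes the case [p = 0] the indicator of [[0,1[]; a strict one would
    give []0,1]]. *)
Lemma bsplineE p x :
  bspline p x = iter p.+1 nabla (fun y => if 0 <= y then y ^+ p else 0) x / p`!%:R.
Proof.
elim: p x => [|p IH] x.
  rewrite /= /nabla divr1 subr_ge0 ltNge.
  case: (leP 0 x) => x0; case: (leP 1 x) => x1 /=; rewrite ?subrr ?subr0 ?expr0//.
  by have := lt_le_trans x0 (le_trans ler01 x1); rewrite ltxx.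
have -> : iter p.+2 nabla (fun y => if 0 <= y then y ^+ p.+1 else 0) x =
    iter p.+2 nabla (fun y => y * (if 0 <= y then y ^+ p else 0)) x.
  by apply: eq_iter_nabla => y; case: ifP => _; rewrite ?mulr0// exprS.
rewrite iter_nablaM_id.
rewrite -[iter p.+2 nabla _ x]/(iter p.+1 nabla _ x - iter p.+1 nabla _ (x - 1)).
rewrite -[bspline _ x]/(x / p.+1%:R * bspline p x +
   (p.+1%:R + 1 - x) / p.+1%:R * bspline p (x - 1)) !IH.
rewrite factS natrM -(natr1 p.+1) -(natr1 p) invfM.
set f := (p`!%:R)^-1; set u := (p%:R + 1)^-1.
ring.
Qed.

(** The reflection swaps the two terms of the recursion. The induction starts at the hat function
    [p = 1], because at [p = 0] it exchanges the endpoints of [[0,1[]. *)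
Lemma bspline_sym p x : (0 < p)%N -> bspline p (p%:R + 1 - x) = bspline p x.
Proof.
elim: p x => // -[_ x _|p IH x _].
  rewrite /=.
  have -> : (0 <= 1 + 1 - x) = (x <= 2) by apply/idP/idP; lra.
  have -> : (1 + 1 - x < 1) = (1 < x) by apply/idP/idP; lra.
  have -> : (0 <= 1 + 1 - x - 1) = (x <= 1) by apply/idP/idP; lra.
  have -> : (1 + 1 - x - 1 < 1) = (0 < x) by apply/idP/idP; lra.
  have -> : (0 <= x - 1) = (1 <= x) by apply/idP/idP; lra.
  have -> : (x - 1 < 1) = (x < 2) by apply/idP/idP; lra.
  by case: (ltgtP x 0) => ?; case: (ltgtP x 1) => ?; case: (ltgtP x 2) => ? /=; lra.
rewrite -[bspline _ x]/(x / p.+2%:R * bspline p.+1 x +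
   (p.+2%:R + 1 - x) / p.+2%:R * bspline p.+1 (x - 1)).
rewrite -[bspline _ (_ - x)]/((p.+2%:R + 1 - x) / p.+2%:R * bspline p.+1 (p.+2%:R + 1 - x) +
   (p.+2%:R + 1 - (p.+2%:R + 1 - x)) / p.+2%:R * bspline p.+1 (p.+2%:R + 1 - x - 1)).
have -> : p.+2%:R + 1 - x = p.+1%:R + 1 - (x - 1) :> R by rewrite -(natr1 p.+1); ring.
have -> : p.+1%:R + 1 - (x - 1) - 1 = p.+1%:R + 1 - x :> R by ring.
rewrite !IH// -(natr1 p.+1); ring.
Qed.

Lemma is_derive_iter_nabla n f g : (forall x, is_derive x 1 f (g x)) ->
  forall x, is_derive x 1 (iter n nabla f) (iter n nabla g x).
Proof.
move=> fg; elim: n => //= n IH x; rewrite /nabla.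
apply: is_deriveB.
have d1 : is_derive x 1 (fun y : R => y - 1) 1 by apply: is_derive_eq; rewrite subr0.
by have := @is_derive1_comp R (iter n nabla f) (fun y => y - 1) x _ _ (IH (x - 1)) d1; rewrite mulr1.
Qed.

(** Each index step up is an antiderivative, so an m-fold derivative is found by exhibiting one
    family [F]. *)
Lemma derive1n_chain (F : nat -> R -> R) : (forall i x, is_derive x 1 (F i.+1) (F i x)) ->
  forall m, derive1n m (F m) = F 0%N.
Proof.
(* The offset [k] lets the induction remove the innermost derivative. *)
move=> FF m; suff H k : derive1n m (F (m + k)%N) = F k by have := H 0%N; rewrite addn0.
elim: m k => // m IH k.
rewrite /derive1n iterSr addSnnS.
have -> : derive1 (F (m + k.+1)%N) = F (m + k)%N.
  by rewrite addnS; apply/funext => x; rewrite derive1E; have [_ ->] := FF (m + k)%N x.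
exact: IH.
Qed.

End Nabla.

(** * Convolution of differenced Riemann-Liouville kernels *)

Section Convolution.
Context {R : realType}.
Notation mu := (@lebesgue_measure R).
Implicit Types (f g h : R -> R) (s t x : R).

(** Integrability is bundled with the value because a real-valued integral splits over differences
    only for integrable functions. *)
Definition is_conv f g h := forall x,
  mu.-integrable setT (fun y => (f y * g (x - y))%:E) /\
  \int[mu]_y (f y * g (x - y)) = h x.

Lemma is_convC f g h : is_conv f g h -> is_conv g f h.
Proof.
move=> fgh x; have [ifg <-] := fgh x.
have E y : f (x - y) * g (x - (x - y)) = g y * f (x - y) by rewrite subKr mulrC.
have := integrable_reflect x _ ifg; under eq_fun do rewrite E.
move=> igf; split => //; congr fine.
rewrite (integral_reflect x _ (measurable_int _ ifg)).
by apply: eq_integral => y _; rewrite E.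
Qed.

(** A translate of [g] by 1 gives the convolution at [x - 1], so one [nabla] passes through by
    linearity of the integral. *)
Lemma is_conv_iter_nablar n f g h : is_conv f g h ->
  is_conv f (iter n nabla g) (iter n nabla h).
Proof.
move=> fgh; elim: n => // n IH x.
have [i1 e1] := IH x; have [i2 e2] := IH (x - 1).
have E y : f y * iter n.+1 nabla g (x - y) =
    f y * iter n nabla g (x - y) - f y * iter n nabla g (x - 1 - y).
  by rewrite /= /nabla mulrBr addrAC.
split; last first.
  under eq_Rintegral do rewrite E.
  by rewrite RintegralB// e1 e2.
have := integrableB measurableT i1 i2; apply: eq_integrable => // y _ /=.
by rewrite E EFinB.
Qed.

Lemma is_conv_iter_nabla m n f g h : is_conv f g h ->
  is_conv (iter m nabla f) (iter n nabla g) (iter (m + n) nabla h).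
Proof.
move=> fgh; rewrite iterD; apply/is_convC/is_conv_iter_nablar/is_convC.
exact: is_conv_iter_nablar.
Qed.

(* Convolution with [rlker s] is the Riemann-Liouville integral of order [s]. *)
Definition rlker s x := tpow s x / Gamma s.

(** The normalisation by [Gamma] turns Euler's formula into the semigroup law. The integrand is
    nonnegative, so the finite value of its integral already gives integrability. *)
Lemma is_conv_rlker s t : 0 < s -> 0 < t ->
  is_conv (rlker s) (rlker t) (rlker (s + t)).
Proof.
move=> s0 t0 x; have m0 := measurable_tpow_conv s t x.
have Gs := Gamma_gt0 _ s0; have Gt := Gamma_gt0 _ t0.
have Gst := Gamma_gt0 _ (addr_gt0 s0 t0).
have I0 : mu.-integrable setT (EFin \o (fun y => tpow s y * tpow t (x - y))).
  apply/integrableP; split; first exact/measurable_EFinP.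
  under eq_integral => y _ do rewrite /= ger0_norm ?mulr_ge0 ?tpow_ge0//.
  by rewrite tpow_conv ?ltry.
have E y : rlker s y * rlker t (x - y) =
    (Gamma s * Gamma t)^-1 * (tpow s y * tpow t (x - y)).
  by rewrite /rlker invfM mulrACA; exact: mulrC.
split.
  by under eq_fun do rewrite E EFinM; exact: integrableZl.
under eq_Rintegral do rewrite E.
rewrite RintegralZl// /Rintegral (tpow_conv s t x s0 t0)/= mulrCA mulKf//.
exact: mulf_neq0 (lt0r_neq0 Gs) (lt0r_neq0 Gt).
Qed.

Lemma tpow_cvg0 s : 1 < s -> tpow s x @[x --> 0^'] --> (0 : R).
Proof.
move=> s1; apply: (@cvg_at_right_left_dnbhs R R^o (tpow s) 0 0).
  have := @powR_cvg0 R (s - 1); rewrite subr_gt0 => /(_ s1) h; apply: cvg_trans h.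
  apply: near_eq_cvg; near=> x.
  by rewrite /tpow ifT//; near: x; exact: nbhs_right_gt.
have h : (cst 0 : R -> R) x @[x --> (0 : R)^'-] --> (0 : R) by exact: cvg_cst.
apply: cvg_trans h; apply: near_eq_cvg; near=> x.
by rewrite /tpow ltNge ltW//; near: x; exact: nbhs_left_lt.
Unshelve. all: by end_near. Qed.

(** Away from 0 this is the power rule or a constant. At 0 the difference quotient in [h] is
    [tpow s h], which tends to 0 because [s > 1]. *)
Lemma is_derive_tpow s x : 1 < s -> is_derive x 1 (tpow (s + 1)) (s * tpow s x).
Proof.
move=> s1; case: (ltgtP x 0) => [x0|x0|->].
- rewrite {2}/tpow ltNge ltW// mulr0.
  apply: near_eq_is_derive (is_derive_cst (0 : R) x 1).
  near=> y; rewrite /tpow ltNge ltW//; near: y; exact: lt_nbhsl.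
- rewrite {2}/tpow x0.
  apply: near_eq_is_derive (is_derive1_powR s x0).
  near=> y; rewrite /tpow addrK ifT//; near: y; exact: lt_nbhsr.
- rewrite {2}/tpow ltxx mulr0.
  have c : h^-1 *: (tpow (s + 1) (h *: 1 + 0) - tpow (s + 1) 0) @[h --> 0^'] --> (0 : R).
    apply: cvg_trans (tpow_cvg0 _ s1); apply: near_eq_cvg; near=> h.
    have h0 : h != 0 by near: h; exact: nbhs_dnbhs_neq.
    rewrite !tpowS mul0r subr0 addr0 /GRing.scale/= mulr1.
    by rewrite mulrA mulVf// mul1r.
  by apply: DeriveDef; [apply/cvg_ex; exists 0|apply/cvg_lim].
Unshelve. all: by end_near. Qed.

Lemma is_derive_rlker s x : 1 < s -> is_derive x 1 (rlker (s + 1)) (rlker s x).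
Proof.
move=> s1; have s0 : 0 < s by rewrite (lt_trans ltr01).
have dt := is_derive_tpow s x s1.
have -> : rlker (s + 1) = (fun y => (Gamma (s + 1))^-1 * tpow (s + 1) y).
  by apply/funext => y; rewrite /rlker mulrC.
apply: is_derive_eq.
rewrite /GRing.scale/= /rlker GammaS//; field.
by rewrite !gt_eqF ?Gamma_gt0.
Qed.

(** For [p > 0] the strict and non-strict truncations agree, since [0 ^+ p = 0]. *)
Lemma bspline_rlker p x : (0 < p)%N ->
  bspline p x = iter p.+1 nabla (rlker p.+1%:R) x.
Proof.
move=> p0; rewrite bsplineE mulrC -iter_nablaZ; apply: eq_iter_nabla => y.
rewrite /rlker Gamma_fact mulrC; congr (_ / _); rewrite /tpow -natr1 addrK.
case: (ltgtP 0 y) => [y0|y0|<-] //; last by rewrite expr0n gtn_eqF.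
by rewrite powR_mulrn ?ltW.
Qed.

End Convolution.

(** * Fractional derivatives of B-splines in closed form *)

Section RiemannLiouville.
Context {R : realType}.
Notation mu := (@lebesgue_measure R).
Implicit Types (a b c x z : R) (p : nat).

Lemma is_conv_bspline_rlker b p : 0 < b -> (0 < p)%N ->
  is_conv (@bspline R p) (rlker b) (iter p.+1 nabla (rlker (p.+1%:R + b))).
Proof.
move=> b0 p0; have -> : @bspline R p = iter p.+1 nabla (rlker p.+1%:R).
  by apply/funext => x; exact: bspline_rlker.
have := is_conv_iter_nabla p.+1 0 _ _ _ (is_conv_rlker p.+1%:R b (ltr0Sn _ _) b0).
by rewrite addn0.
Qed.

Lemma Rintegral_tpow_bspline b p z : 0 < b -> (0 < p)%N ->
  \int[mu]_y (tpow b (z - y) * bspline p y) =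
  Gamma b * iter p.+1 nabla (rlker (p.+1%:R + b)) z.
Proof.
move=> b0 p0; have [i <-] := is_conv_bspline_rlker b p b0 p0 z.
rewrite -RintegralZl//; apply: eq_Rintegral => y _.
by rewrite /rlker; field; rewrite gt_eqF// Gamma_gt0.
Qed.

Lemma integrable_tpow_bspline b p z : 0 < b -> (0 < p)%N ->
  mu.-integrable setT (fun y => (tpow b (z - y) * bspline p y)%:E).
Proof.
move=> b0 p0; have [i _] := is_conv_bspline_rlker b p b0 p0 z.
have := integrableZl measurableT (Gamma b) i; apply: eq_integrable => // y _.
rewrite -EFinM; congr EFin.
by rewrite /rlker; field; rewrite gt_eqF// Gamma_gt0.
Qed.

Lemma Rintegral_left b (u : R -> R) z :
  \int[mu]_(y in `]-oo, z[) ((z - y) `^ (b - 1) * u y) =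
  \int[mu]_y (tpow b (z - y) * u y).
Proof.
rewrite Rintegral_mkcond; apply: eq_Rintegral => y _.
by rewrite patchE mem_setE in_itv/= /tpow subr_gt0; case: ifP; rewrite ?mul0r.
Qed.

Lemma Rintegral_right b (u : R -> R) z :
  \int[mu]_(y in `]z, +oo[) ((y - z) `^ (b - 1) * u y) =
  \int[mu]_y (tpow b (y - z) * u y).
Proof.
rewrite Rintegral_mkcond; apply: eq_Rintegral => y _.
by rewrite patchE mem_setE in_itv/= andbT /tpow subr_gt0; case: ifP; rewrite ?mul0r.
Qed.

Lemma is_derive_iter_nabla_rlker n s x : 1 < s ->
  is_derive x 1 (iter n nabla (rlker (s + 1))) (iter n nabla (rlker s) x).
Proof.
by move=> s1; apply: is_derive_iter_nabla => y; exact: is_derive_rlker.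
Qed.

(** The fractional integral of order [m - a] raises the kernel index to [p + 1 + m - a], and m
    derivatives lower it to [p + 1 - a]. As [a < p], every index met stays above 1, so each
    derivative exists at every point. *)
Lemma RL_left_bspline a p x : 0 <= a -> a < p%:R ->
  RL_left a (bspline p) x = iter p.+1 nabla (rlker (p.+1%:R - a)) x.
Proof.
move=> a0 ap; have p0 : (0 < p)%N by rewrite -(ltr0n R) (le_lt_trans a0).
rewrite /RL_left; set m := fracm a; set b := m%:R - a.
have b0 : 0 < b by rewrite subr_gt0 truncnS_gt.
have Gb := Gamma_gt0 _ b0.
(* [F m] is the integral inside [RL_left] and [F 0] its m-th derivative; the factor [Gamma b]
   cancels the normalisation at the end. *)
pose F (i : nat) z := Gamma b * iter p.+1 nabla (rlker (p.+1%:R - a + i%:R)) z.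
have -> : (fun z => \int[mu]_(y in `]-oo, z[) ((z - y) `^ (b - 1) * bspline p y)) = F m.
  apply/funext => z; rewrite Rintegral_left (Rintegral_tpow_bspline b p z b0 p0) /F.
  by rewrite /b addrA addrAC.
have FF i z : is_derive z 1 (F i.+1) (F i z).
  have s1 : 1 < p.+1%:R - a + i%:R.
    by rewrite -natr1; have := ler0n R i; lra.
  have d := is_derive_iter_nabla_rlker p.+1 _ z s1.
  rewrite /F -(natr1 i) addrA.
  exact: is_deriveZ.
rewrite (derive1n_chain F FF).
by rewrite /F addr0 mulKf// gt_eqF.
Qed.

Lemma RL_right_bspline a p x : 0 <= a -> a < p%:R ->
  RL_right a (bspline p) x =
  iter p.+1 nabla (rlker (p.+1%:R - a)) (p%:R + 1 - x).
Proof.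
move=> a0 ap; have p0 : (0 < p)%N by rewrite -(ltr0n R) (le_lt_trans a0).
rewrite /RL_right; set m := fracm a; set b := m%:R - a; set c := p%:R + 1.
have b0 : 0 < b by rewrite subr_gt0 truncnS_gt.
have Gb := Gamma_gt0 _ b0.
have mm : (-1) ^+ m * (-1) ^+ m = 1 :> R by rewrite -exprMn mulN1r opprK expr1n.
pose D (i : nat) := iter p.+1 nabla (rlker (p.+1%:R - a + i%:R)).
(* Differentiating in [c - z] costs a sign each time, hence [(-1) ^+ i]. With the constant
   [(-1) ^+ m] the signs cancel in [F m], and [F 0] keeps the sign that the definition of [RL_right]
   removes. *)
pose F (i : nat) z := Gamma b * (-1) ^+ m * ((-1) ^+ i * D i (c - z)).
have -> : (fun z => \int[mu]_(y in `]z, +oo[) ((y - z) `^ (b - 1) * bspline p y)) = F m.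
  apply/funext => z; rewrite Rintegral_right.
  have mi := measurable_int _ (integrable_tpow_bspline b p (c - z) b0 p0).
  (* The reflection [c - y] and the symmetry of the B-spline turn the right-sided integral at [z]
     into the left-sided one at [c - z]. *)
  transitivity (\int[mu]_y (tpow b (c - z - y) * bspline p y)).
    apply: (congr1 fine); apply/esym; etransitivity; first exact: (integral_reflect c _ mi).
    apply: eq_integral => y _; rewrite bspline_sym//; congr (tpow b _ * _)%:E.
    by rewrite /c; ring.
  rewrite (Rintegral_tpow_bspline b p _ b0 p0) /F mulrA -(mulrA (Gamma b)) mm mulr1.
  by rewrite /D /b addrA addrAC.
have FF i z : is_derive z 1 (F i.+1) (F i z).
  have s1 : 1 < p.+1%:R - a + i%:R.
    by rewrite -natr1; have := ler0n R i; lra.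
  have d := is_derive_iter_nabla_rlker p.+1 _ (c - z) s1.
  have dc : is_derive z 1 (fun y : R => c - y) (-1).
    by apply: is_derive_eq; rewrite add0r mul1r.
  have dd := @is_derive1_comp R _ (fun y => c - y) z _ _ d dc.
  have -> : F i z = Gamma b * (-1) ^+ m * (-1) ^+ i.+1 * (D i (c - z) * -1).
    by rewrite /F exprS; ring.
  have -> : F i.+1 = (fun y => Gamma b * (-1) ^+ m * (-1) ^+ i.+1 *
      (iter p.+1 nabla (rlker (p.+1%:R - a + i%:R + 1)) \o (fun y => c - y)) y).
    by apply/funext => y; rewrite /F /D /= -(natr1 i) addrA mulrA.
  exact: is_deriveZ.
rewrite (derive1n_chain F FF).
rewrite /F /D addr0 expr0 mul1r.
transitivity (((-1) ^+ m * (-1) ^+ m) * (Gamma b / Gamma b) *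
  iter p.+1 nabla (rlker (p.+1%:R - a)) (c - x)); first by ring.
by rewrite mm divff ?gt_eqF// !mul1r.
Qed.

End RiemannLiouville.

(** * The two integral identities *)

Theorem theorem3p3 (R : realType) (p1 p2 : nat) (a1 a2 : R) :
  (1 <= p1)%N -> (1 <= p2)%N ->
  0 <= a1 -> a1 < p1%:R -> 0 <= a2 -> a2 < p2%:R ->
  forall k : R,
    ((@lebesgue_measure R).-integrable setT
        (fun x => (RL_left a1 (@bspline R p1) x *
                   RL_right a2 (@bspline R p2) (x + k))%:E) /\
     Rintegral (@lebesgue_measure R) setT
        (fun x => RL_left a1 (@bspline R p1) x *
                  RL_right a2 (@bspline R p2) (x + k))
     = RL_left (a1 + a2) (@bspline R (p1 + p2 + 1)) (p2%:R + 1 - k))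
    /\
    ((@lebesgue_measure R).-integrable setT
        (fun x => (RL_right a1 (@bspline R p1) x *
                   RL_left a2 (@bspline R p2) (x + k))%:E) /\
     Rintegral (@lebesgue_measure R) setT
        (fun x => RL_right a1 (@bspline R p1) x *
                  RL_left a2 (@bspline R p2) (x + k))
     = RL_right (a1 + a2) (@bspline R (p1 + p2 + 1)) (p2%:R + 1 - k)).
Proof.
move=> _ _ a1_ge0 a1_lt a2_ge0 a2_lt k.
have a12 : a1 + a2 < (p1 + p2 + 1)%:R.
  by rewrite !natrD ltr_wpDr// ltrD.
(* Orders of differences and kernel indices both add up: [p1 + 1] and [p2 + 1] make [p1 + p2 + 2],
   which fits the B-spline of degree [p1 + p2 + 1]. *)
have F12 : is_conv (iter p1.+1 nabla (rlker (p1.+1%:R - a1)))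
    (iter p2.+1 nabla (rlker (p2.+1%:R - a2)))
    (iter (p1 + p2 + 1).+1 nabla (rlker ((p1 + p2 + 1).+1%:R - (a1 + a2)))).
  have -> : (p1 + p2 + 1).+1 = (p1.+1 + p2.+1)%N by rewrite addn1 addSn addnS.
  have -> : (p1.+1 + p2.+1)%:R - (a1 + a2) = (p1.+1%:R - a1) + (p2.+1%:R - a2).
    by rewrite natrD; ring.
  have lt_S (p : nat) (a : R) : a < p%:R -> 0 < p.+1%:R - a.
    by move=> ap; rewrite subr_gt0 (lt_trans ap)// ltr_nat.
  by apply: is_conv_iter_nabla; apply: is_conv_rlker; exact: lt_S.
split.
  (* The right derivative at [x + k] has argument [p2 + 1 - (x + k)], so the integral is the
     convolution at [p2 + 1 - k]. *)
  have [i e] := F12 (p2%:R + 1 - k).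
  have E x : RL_left a1 (bspline p1) x * RL_right a2 (bspline p2) (x + k) =
      iter p1.+1 nabla (rlker (p1.+1%:R - a1)) x *
      iter p2.+1 nabla (rlker (p2.+1%:R - a2)) (p2%:R + 1 - k - x).
    by rewrite RL_left_bspline// RL_right_bspline// opprD addrA addrAC.
  split; first by apply: eq_integrable i => // x _; rewrite E.
  rewrite RL_left_bspline ?addr_ge0// -e.
  by apply: eq_Rintegral => x _; exact: E.
(* Now the first factor is the reflected one. In the variable [p1 + 1 - x] the integral is a
   convolution, and the two arguments sum to [p1 + 1 + k]. *)
have [i e] := F12 (p1%:R + 1 + k).
have E x : RL_right a1 (bspline p1) x * RL_left a2 (bspline p2) (x + k) =
    iter p1.+1 nabla (rlker (p1.+1%:R - a1)) (p1%:R + 1 - x) *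
    iter p2.+1 nabla (rlker (p2.+1%:R - a2)) (p1%:R + 1 + k - (p1%:R + 1 - x)).
  have -> : p1%:R + 1 + k - (p1%:R + 1 - x) = x + k by ring.
  by rewrite RL_right_bspline// RL_left_bspline.
split.
  have := integrable_reflect (p1%:R + 1) _ i.
  by apply: eq_integrable => // x _; rewrite E.
rewrite RL_right_bspline ?addr_ge0//.
(* The reflection belonging to degree [p1 + p2 + 1] sends the stated evaluation point to the
   convolution point. *)
have -> : (p1 + p2 + 1)%:R + 1 - (p2%:R + 1 - k) = p1%:R + 1 + k.
  by rewrite !natrD; ring.
rewrite -e; apply: (congr1 fine); apply/esym; etransitivity.
  exact: (integral_reflect (p1%:R + 1) _ (measurable_int _ i)).
by apply: eq_integral => x _; rewrite E.
Qed.
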